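(* Let $n\ge 1$ and let $(D,h_D)$ be the Hilbert geometry of a bounded convex domain $D\subset\mathbb{E}^n$. Then: (i) every geodesic ray in $(D,h_D)$ converges to a point of $\partial D$; that is, for every geodesic ray $\gamma:[0,\infty)\to D$ there is $\xi\in\partial D$ such that $\gamma(t)\to\xi$ as $t\to\infty$; (ii) every complete geodesic $\Gamma:\mathbb{R}\to D$ in $(D,h_D)$ has precisely two accumulation points on $\partial D$; that is, the set of points of $\partial D$ that are limits of sequences $\Gamma(t_k)$ with $t_k\in\mathbb{R}$ has exactly two elements.
   Context: $\mathbb{E}^n$ denotes $n$-dimensional Euclidean space, and $|xy|$ the Euclidean distance between $x,y\in\mathbb{E}^n$. A bounded convex domain is a nonempty bounded open convex subset $D\subset\mathbb{E}^n$; $\partial D$ is its boundary in $\mathbb{E}^n$. The Hilbert metric $h_D:D\times D\to[0,\infty)$ is defined by $h_D(x,x)=0$ and, for $x\neq y$ in $D$, $$h_D(x,y)=\log\frac{|y\bar{x}|\cdot|x\bar{y}|}{|x\bar{x}|\cdot|y\bar{y}|},$$ where $\bar{x},\bar{y}$ are the two intersection points of $\partial D$ with the straight line through $x$ and $y$, labelled so that $|\bar{x}x|<|\bar{x}y|$ and $|\bar{y}x|>|\bar{y}y|$. The metric space $(D,h_D)$ is called a Hilbert geometry. A geodesic ray is a map $\gamma:[0,\infty)\to D$ with $h_D(\gamma(s),\gamma(t))=|s-t|$ for all $s,t\ge 0$; a complete geodesic is a map $\Gamma:\mathbb{R}\to D$ with $h_D(\Gamma(s),\Gamma(t))=|s-t|$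 for all $s,t\in\mathbb{R}$ (geodesics need not be straight line segments). Convergence to points of $\partial D$ is with respect to the Euclidean topology on $\overline{D}=D\cup\partial D$. *)

(* Defs.v *)
From mathcomp Require Import all_boot all_order all_algebra.
From mathcomp Require Import all_classical all_reals all_analysis.
Import Order.TTheory GRing.Theory Num.Theory.
Import numFieldNormedType.Exports.

Set Implicit Arguments.
Unset Strict Implicit.
Unset Printing Implicit Defensive.

Local Open Scope classical_set_scope.
Local Open Scope ring_scope.

(* E^n is 'rV[R]_n.  The library norm on 'rV[R]_n is the sup norm; it induces
   the Euclidean topology and the same bounded sets, so it is used only for
   [open], [closure], [bounded_set] and limits.  Distances are [edist]. *)
Definition edist (R : realType) (n : nat) (x y : 'rV[R]_n) : R :=
  Num.sqrt (\sum_(i < n) (x 0 i - y 0 i) ^+ 2).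

Definition line (R : realType) (n : nat) (x y : 'rV[R]_n) : set 'rV[R]_n :=
  [set p | exists k : R, p = x + k *: (y - x)].

Definition boundary (T : topologicalType) (A : set T) : set T :=
  closure A `\` A°.

Definition bounded_convex_domain (R : realType) (n : nat)
    (D : set 'rV[R]_n) : Prop :=
  [/\ D !=set0, bounded_set D, open D & convex_set D].

(* The end, on the side of x, of the chord of D through x and y.  For x <> y in
   a bounded convex domain exactly one point satisfies the description, so the
   default value 0 is never used.  The other end of the chord is
   [chord_end D y x]. *)
Definition chord_end (R : realType) (n : nat) (D : set 'rV[R]_n)
    (x y : 'rV[R]_n) : 'rV[R]_n :=
  xget 0 [set p | [/\ boundary D p, line x y p & edist p x < edist p y]].

Definition hilbert_dist (R : realType) (n : nat) (D : set 'rV[R]_n)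
    (x y : 'rV[R]_n) : R :=
  if x == y then 0 else
  let xbar := chord_end D x y in
  let ybar := chord_end D y x in
  ln ((edist y xbar * edist x ybar) / (edist x xbar * edist y ybar)).

(* Only the restriction of g to [0, +oo[ matters. *)
Definition geodesic_ray (R : realType) (n : nat) (D : set 'rV[R]_n)
    (g : R -> 'rV[R]_n) : Prop :=
  (forall t, 0 <= t -> D (g t)) /\
  (forall s t, 0 <= s -> 0 <= t -> hilbert_dist D (g s) (g t) = `|s - t|).

Definition complete_geodesic (R : realType) (n : nat) (D : set 'rV[R]_n)
    (g : R -> 'rV[R]_n) : Prop :=
  (forall t, D (g t)) /\
  (forall s t, hilbert_dist D (g s) (g t) = `|s - t|).

Definition boundary_accumulation (R : realType) (n : nat) (D : set 'rV[R]_n)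
    (g : R -> 'rV[R]_n) : set 'rV[R]_n :=
  [set xi | boundary D xi /\
    exists t : nat -> R, g (t k) @[k --> \oo] --> xi].

(* Main.v *)
From HB Require Import structures.
From Pilot Require Import Defs.
From mathcomp Require Import all_boot all_order all_algebra.
From mathcomp Require Import all_classical all_reals all_analysis.
From mathcomp Require Import ring lra.
Import Order.TTheory GRing.Theory Num.Theory.
Import numFieldNormedType.Exports.

Local Open Scope classical_set_scope.
Local Open Scope ring_scope.
Set Implicit Arguments.
Unset Strict Implicit.

(** The Hilbert metric is the symmetrization of the Funk metric: if b is the
    end of the chord of D on the side of y and r(x,y) = |y b| / |x b|, then
    h(x,y) = - ln r(x,y) - ln r(y,x).  Since y = r(x,y) x + (1 - r(x,y)) b, and
    r(x,y) is the largest weight l for which y = l x + (1 - l) p with p in the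
    closure of D ([funk_ratio_max]), convexity gives
    r(x,z) >= r(x,y) r(y,z) ([funk_ratio_triangle]).  Both Funk terms satisfy
    the triangle inequality, so equality for their sum forces equality for each
    of them: along a geodesic, which need not be straight, r is multiplicative
    both forwards and backwards ([funk_ratio_geodesic]).

    Convergence of rays comes from the backward direction.  The function
    a(t) = r(g t, g 0) is nonincreasing, and it is bounded below by some c > 0
    because g 0 is interior and D is bounded.  For s <= t,
    a(t) = r(g t, g s) a(s), and g s = r(g t, g s) g t + (1 - r(g t, g s)) p,
    whence
      |g s - g t| <= (1 - r(g t, g s)) diam D <= diam D / c (a(s) - a(t)).
    The monotone bounded function a is Cauchy at infinity, hence so is g
    ([ray_cvg]).  The limit is on the boundary, because h(g 0, .) is bounded
    near every point of D ([ray_limit_boundary]).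

    For a complete geodesic G, both G t and G (- t) therefore converge.  The
    limits differ by [funk_ratio_separation]: if a ball of radius rho about o
    lies in D and o is between x and y in the sense that
    r(x,y) = r(x,o) r(o,y), then |x y| >= (1 - r(x,y)) rho; for x = G (- t),
    y = G t, o = G 0 the right-hand side stays above a positive constant.
    Nothing else accumulates on the boundary, since G t stays away from it
    while t is bounded ([accumulation_unbounded]). *)

(** * Convex sets and their closures *)

Section ConvexGeometry.
Context {R : realType} {n : nat}.
Implicit Types (D : set 'rV[R]_n) (x y z p q b : 'rV[R]_n) (l r : R).

Lemma closureP D p :
  closure D p <-> forall e, 0 < e -> exists2 q, D q & `|p - q| < e.
Proof.
split=> [cp e e0|h B /nbhs_ballP[e /= e0 eB]].
  have [q [Dq]] := cp _ (nbhsx_ballx p e e0).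
  by rewrite -ball_normE /= => pq; exists q.
have [q Dq pq] := h e e0; exists q; split=> //.
by apply: eB; rewrite -ball_normE.
Qed.

Lemma convex_setP D x y l : convex_set D -> D x -> D y -> 0 <= l -> l <= 1 ->
  D (l *: x + (1 - l) *: y).
Proof.
move=> cD Dx Dy l0 l1.
by have := cD x y (Itv01 l0 l1); rewrite !inE; apply.
Qed.

Lemma closure_convex D p q l : convex_set D -> closure D p -> closure D q ->
  0 <= l -> l <= 1 -> closure D (l *: p + (1 - l) *: q).
Proof.
move=> cD /closureP cp /closureP cq l0 l1; apply/closureP => e e0.
have e20 : 0 < e / 2 by rewrite divr_gt0.
have [p' Dp' pp'] := cp _ e20; have [q' Dq' qq'] := cq _ e20.
exists (l *: p' + (1 - l) *: q'); first exact: convex_setP.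
have -> : l *: p + (1 - l) *: q - (l *: p' + (1 - l) *: q') =
          l *: (p - p') + (1 - l) *: (q - q').
  by apply/rowP => i; rewrite !mxE; ring.
apply: le_lt_trans (ler_normD _ _) _.
rewrite !normrZ (ger0_norm l0) (ger0_norm (_ : 0 <= 1 - l)) ?subr_ge0//.
have h1 : l * `|p - p'| <= l * (e / 2) by rewrite ler_wpM2l// ltW.
have h2 : (1 - l) * `|q - q'| <= (1 - l) * (e / 2).
  by rewrite ler_wpM2l ?subr_ge0// ltW.
lra.
Qed.

(** Contracting D towards a point p of its closure keeps it inside D: if p were
    in D this would be convexity alone; an approximation q of p in D closer than
    the slack left in the strict inequality does as well. *)
Lemma ball_conv_closure D y p r l : convex_set D -> ball y r `<=` D ->
  closure D p -> 0 < l -> l <= 1 -> ball (l *: y + (1 - l) *: p) (l * r) `<=` D.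
Proof.
move=> cD yD /closureP cp l0 l1 z; rewrite -ball_normE /= => zr.
set c := l *: y + (1 - l) *: p in zr *.
have d0 : 0 < l * r - `|c - z| by rewrite subr_gt0.
have [q Dq pq] := cp _ d0.
have -> : z = l *: (l^-1 *: (z - (1 - l) *: q)) + (1 - l) *: q.
  by rewrite scalerA divff ?gt_eqF// scale1r subrK.
apply: convex_setP => //; last exact: ltW.
apply: yD; rewrite -ball_normE /=.
have -> : y - l^-1 *: (z - (1 - l) *: q) =
          l^-1 *: ((c - z) - (1 - l) *: (p - q)).
  by apply/rowP => i; rewrite /c !mxE; field; rewrite gt_eqF.
rewrite normrZ gtr0_norm ?invr_gt0// mulrC ltr_pdivrMr// mulrC.
apply: le_lt_trans (ler_normB _ _) _.
rewrite normrZ (ger0_norm (_ : 0 <= 1 - l)) ?subr_ge0//.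
have m0 := normr_ge0 (p - q); nra.
Qed.

Lemma open_ball D y : open D -> D y -> exists2 r, 0 < r & ball y r `<=` D.
Proof.
move=> oD Dy; have /nbhs_ballP[r /= r0 h] := open_nbhs_nbhs (conj oD Dy).
by exists r.
Qed.

Lemma boundary_openP D b : open D -> boundary D b <-> closure D b /\ ~ D b.
Proof. by move=> oD; rewrite /boundary ((interior_id D).1 oD). Qed.

Lemma bounded_norm D : bounded_set D ->
  exists2 M, 0 < M & forall p, closure D p -> `|p| <= M.
Proof.
move=> bD; have [M M0 hM] := pinfty_ex_gt0 bD; exists M => // p /closureP cp.
apply/ler_addgt0Pr => e e0; have [q Dq pq] := cp e e0.
have hq : `|q| <= M := hM q Dq.
rewrite -[p](subrK q); apply: le_trans (ler_normD _ _) _; lra.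
Qed.

Lemma edistZ (a b c d : 'rV[R]_n) l : a - b = l *: (c - d) ->
  Defs.edist a b = `|l| * Defs.edist c d.
Proof.
move=> /rowP h; rewrite /edist -sqrtr_sqr -sqrtrM ?sqr_ge0//; congr Num.sqrt.
rewrite mulr_sumr; apply: eq_bigr => i _; have := h i; rewrite !mxE => ->; ring.
Qed.

Lemma edist_gt0 x y : x != y -> 0 < Defs.edist x y.
Proof.
move=> xy; rewrite /Defs.edist sqrtr_gt0 lt0r sumr_ge0 ?andbT; last first.
  by move=> i _; exact: sqr_ge0.
apply: contra xy => /eqP h; apply/eqP/rowP => i.
have /psumr_eq0P : forall i : 'I_n, true -> 0 <= (x 0 i - y 0 i) ^+ 2.
  by move=> ? _; exact: sqr_ge0.
by move=> /(_ h i isT)/eqP; rewrite sqrf_eq0 subr_eq0 => /eqP.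
Qed.

End ConvexGeometry.

(** * Ends of chords *)

Section Chord.
Context {R : realType} {n : nat} {D : set 'rV[R]_n}.
Context (hD : bounded_convex_domain D).
Implicit Types (x y z p q b : 'rV[R]_n) (l r : R).

(** The boundary point is where the ray from x away from y leaves D for the last
    time; the supremum of the parameters that stay in D is finite because D is
    bounded. *)
Lemma chord_end_exists x y : D x -> x != y ->
  exists2 m, 0 < m & boundary D (x + m *: (x - y)).
Proof.
case: hD => _ bD oD cD Dx xy.
have nxy : 0 < `|x - y| by rewrite normr_gt0 subr_eq0.
pose S := [set m : R | 0 <= m /\ D (x + m *: (x - y))].
have S0 : S 0 by split=> //; rewrite scale0r addr0.
have [M M0 hM] := bounded_norm bD.
have Sub : has_ubound S.
  exists ((M + M) / `|x - y|) => m [m0 /subset_closure /hM h].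
  rewrite ler_pdivlMr//.
  have -> : m * `|x - y| = `|(x + m *: (x - y)) - x|.
    by rewrite addrAC subrr add0r normrZ ger0_norm.
  apply: le_trans (ler_normB _ _) _; apply: lerD => //.
  exact/hM/subset_closure.
have supS : has_sup S by split=> //; exists 0.
have s0 : 0 <= sup S by exact: ub_le_sup.
have nS : ~ D (x + sup S *: (x - y)).
  move=> /(open_ball oD)[r r0 hr].
  pose d := r / (2 * `|x - y|).
  have d0 : 0 < d by rewrite divr_gt0// mulr_gt0.
  suff : S (sup S + d) by move=> /(ub_le_sup Sub); lra.
  split; first lra.
  apply: hr; rewrite -ball_normE /=.
  have -> : x + sup S *: (x - y) - (x + (sup S + d) *: (x - y)) =
          (- d) *: (x - y).
    by apply/rowP => i; rewrite !mxE; ring.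
  rewrite normrZ normrN gtr0_norm// /d.
  have -> : r / (2 * `|x - y|) * `|x - y| = r / 2 by field; rewrite gt_eqF.
  lra.
exists (sup S).
  rewrite lt_neqAle s0 andbT; apply/negP => /eqP e.
  by apply: nS; rewrite -e scale0r addr0.
apply/boundary_openP => //; split=> //; apply/closureP => e e0.
have [|m [m0 Dm] hm] := sup_adherent (_ : 0 < e / `|x - y|) supS.
  exact: divr_gt0.
exists (x + m *: (x - y)) => //.
have -> : x + sup S *: (x - y) - (x + m *: (x - y)) = (sup S - m) *: (x - y).
  by apply/rowP => i; rewrite !mxE; ring.
have mS : m <= sup S by apply: ub_le_sup.
by rewrite normrZ ger0_norm ?subr_ge0// -ltr_pdivlMr//; lra.
Qed.

(** Being closer to x than to y puts the point on the line before the midpoint;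
    the segment from x to y lies in the open set D, so the point lies strictly
    before x. *)
Lemma chord_endP x y : D x -> D y -> x != y ->
  exists m, [/\ 0 < m, chord_end D x y = x + m *: (x - y) &
                boundary D (chord_end D x y)].
Proof.
move=> Dx Dy xy; case: (hD) => _ bD oD cD.
have e0 := edist_gt0 xy.
have [m0 m00 hm0] := chord_end_exists Dx xy.
have [|bb [k kE] lt] := xgetPex 0 (_ : exists p,
    [set p | [/\ boundary D p, line x y p & Defs.edist p x < Defs.edist p y]] p).
  exists (x + m0 *: (x - y)); split=> //.
    by exists (- m0); apply/rowP => i; rewrite !mxE; ring.
  have -> : Defs.edist (x + m0 *: (x - y)) x = `|m0| * Defs.edist x y.
    by apply: edistZ; apply/rowP => i; rewrite !mxE; ring.
  have -> : Defs.edist (x + m0 *: (x - y)) y = `|1 + m0| * Defs.edist x y.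
    by apply: edistZ; apply/rowP => i; rewrite !mxE; ring.
  rewrite ltr_pM2r// !gtr0_norm; lra.
rewrite -/(chord_end D x y) in bb kE lt *; set b := chord_end D x y in bb kE lt *.
exists (- k); split=> //; last by rewrite kE; apply/rowP => i; rewrite !mxE; ring.
rewrite oppr_gt0 ltNge; apply/negP => k0.
have k1 : k <= 1.
  rewrite leNgt; apply/negP => k1.
  have bx : Defs.edist b x = `|- k| * Defs.edist x y.
    by apply: edistZ; rewrite kE; apply/rowP => i; rewrite !mxE; ring.
  have yb : Defs.edist b y = `|1 - k| * Defs.edist x y.
    by apply: edistZ; rewrite kE; apply/rowP => i; rewrite !mxE; ring.
  move: lt; rewrite bx yb normrN (ger0_norm k0) ltr_pM2r// ltr0_norm; lra.
have [_] := (boundary_openP _ oD).1 bb; apply.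
have -> : b = k *: y + (1 - k) *: x.
  by rewrite kE; apply/rowP => i; rewrite !mxE; ring.
exact: convex_setP.
Qed.

End Chord.

(** * Funk ratios *)

(** This is exp (- F x y) for the Funk metric F of D.  The diagonal is separate
    because no chord passes through x and x. *)
HB.lock Definition funk_ratio (R : realType) (n : nat) (D : set 'rV[R]_n)
    (x y : 'rV[R]_n) : R :=
  if x == y then 1 else
  Defs.edist y (chord_end D y x) / Defs.edist x (chord_end D y x).

Section Funk.
Context {R : realType} {n : nat} {D : set 'rV[R]_n}.
Context (hD : bounded_convex_domain D).
Implicit Types (x y z p q b : 'rV[R]_n) (l r : R).
Local Notation fr := (funk_ratio D).

Lemma funk_ratio_chord x y : D x -> D y -> x != y ->
  exists b, [/\ boundary D b, y = fr x y *: x + (1 - fr x y) *: b,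
                0 < fr x y & fr x y < 1].
Proof.
move=> Dx Dy xy; have yx : y != x by rewrite eq_sym.
have [m [m0 bE bb]] := chord_endP hD Dy Dx yx.
have e0 := edist_gt0 yx.
have E : fr x y = m / (1 + m).
  have yb : Defs.edist y (chord_end D y x) = `|- m| * Defs.edist y x.
    by apply: edistZ; rewrite bE; apply/rowP => i; rewrite !mxE; ring.
  have xb : Defs.edist x (chord_end D y x) = `|- (1 + m)| * Defs.edist y x.
    by apply: edistZ; rewrite bE; apply/rowP => i; rewrite !mxE; ring.
  have m1 : 0 < 1 + m by lra.
  rewrite funk_ratio.unlock (negbTE xy) yb xb !normrN !gtr0_norm//.
  by field; rewrite !gt_eqF.
have m1 : 1 + m != 0 by rewrite gt_eqF//; lra.
exists (chord_end D y x); split=> //; rewrite E.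
- by rewrite bE; apply/rowP => i; rewrite !mxE; field.
- by rewrite divr_gt0//; lra.
- by rewrite ltr_pdivrMr; lra.
Qed.

Lemma funk_ratio_bounds x y : D x -> D y -> 0 < fr x y <= 1.
Proof.
move=> Dx Dy; have [<-|xy] := eqVneq x y; first last.
  by have [b [_ _ -> /ltW]] := funk_ratio_chord Dx Dy xy.
by rewrite funk_ratio.unlock eqxx lexx ltr01.
Qed.

Lemma funk_ratioP x y : D x -> D y ->
  exists2 p, closure D p & y = fr x y *: x + (1 - fr x y) *: p.
Proof.
move=> Dx Dy; have [<-|xy] := eqVneq x y.
  exists x; first exact: subset_closure.
  by rewrite -scalerDl addrC subrK scale1r.
have [b [[cb _] h _ _]] := funk_ratio_chord Dx Dy xy.
by exists b.
Qed.

(** A larger weight l would exhibit the chord end b as a point strictly between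
    x and p, which is interior to D by [ball_conv_closure]. *)
Lemma funk_ratio_max x y p l : D x -> D y -> closure D p -> l <= 1 ->
  y = l *: x + (1 - l) *: p -> l <= fr x y.
Proof.
move=> Dx Dy cp l1 yE; case: (hD) => _ bD oD cD.
have [xy|xy] := eqVneq x y; first by rewrite funk_ratio.unlock xy eqxx.
have [b [bb yb r0 r1]] := funk_ratio_chord Dx Dy xy.
set r := fr x y in yb r0 r1 *; rewrite leNgt; apply/negP => rl.
have [_] := (boundary_openP _ oD).1 bb; apply.
have [s s0 sD] := open_ball oD Dx.
(* k comes from eliminating y between y = r x + (1 - r) b and
   y = l x + (1 - l) p. *)
pose k := (l - r) / (1 - r).
have k0 : 0 < k by rewrite divr_gt0//; lra.
have k1 : k <= 1 by rewrite ler_pdivrMr; lra.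
have -> : b = k *: x + (1 - k) *: p.
  apply/rowP => i; move/rowP/(_ i) : yb; rewrite {1}yE !mxE => h.
  have r1' : 1 - r != 0 by rewrite gt_eqF//; lra.
  have -> : b 0 i = (l * x 0 i + (1 - l) * p 0 i - r * x 0 i) / (1 - r).
    by rewrite h; field.
  by rewrite /k; field.
apply: (ball_conv_closure cD sD cp k0 k1).
by apply: ballxx; rewrite mulr_gt0.
Qed.

(** Substituting y = a x + (1 - a) p into z = b y + (1 - b) q writes z with
    weight a b on x, and the remaining weight on a combination of p and q, which
    is again in the closure of D; the maximality of r(x,z) concludes. *)
Lemma funk_ratio_triangle x y z : D x -> D y -> D z ->
  fr x y * fr y z <= fr x z.
Proof.
move=> Dx Dy Dz; case: (hD) => _ _ _ cD.
have /andP[a0 a1] := funk_ratio_bounds Dx Dy.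
have /andP[b0 b1] := funk_ratio_bounds Dy Dz.
have [p cp yE] := funk_ratioP Dx Dy; have [q cq zE] := funk_ratioP Dy Dz.
set a := fr x y in a0 a1 yE *; set b := fr y z in b0 b1 zE *.
have ab1 : a * b <= 1 by nra.
have [ab|ab] := eqVneq (a * b) 1.
  have b1' : b = 1 by nra.
  have a1' : a = 1 by nra.
  move: yE zE; rewrite a1' b1' !subrr !scale0r !addr0 !scale1r mulr1 => -> ->.
  by rewrite funk_ratio.unlock eqxx.
have abp : 0 < 1 - a * b by rewrite subr_gt0 lt_neqAle ab.
pose k := b * (1 - a) / (1 - a * b).
apply: (@funk_ratio_max x z (k *: p + (1 - k) *: q)) => //.
  apply: closure_convex => //.
  - by rewrite divr_ge0// ?mulr_ge0 ?subr_ge0// ltW.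
  - by rewrite ler_pdivrMr// mul1r; nra.
have abn : 1 - a * b != 0 by rewrite gt_eqF.
rewrite zE yE; apply/rowP => i; rewrite /k !mxE; field; exact: abn.
Qed.

Lemma expR_hilbert_dist x y : D x -> D y ->
  expR (- hilbert_dist D x y) = fr x y * fr y x.
Proof.
move=> Dx Dy; rewrite /hilbert_dist.
have [xy|xy] := eqVneq x y.
  by rewrite xy oppr0 expR0 funk_ratio.unlock eqxx mulr1.
have yx : y != x by rewrite eq_sym.
have /andP[+ _] := funk_ratio_bounds Dx Dy.
have /andP[+ _] := funk_ratio_bounds Dy Dx.
rewrite funk_ratio.unlock (negbTE xy) (negbTE yx).
set a := Defs.edist x _; set b := Defs.edist y _.
set c := Defs.edist y _; set d := Defs.edist x _ => h1 h2.
have sgn (u v : R) : 0 < u / v -> 0 <= u -> 0 < u /\ 0 < v.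
  move=> uv u0; have u1 : 0 < u.
    by rewrite lt_neqAle u0 andbT; apply/negP => /eqP e; move: uv; rewrite -e mul0r ltxx.
  by split=> //; move: uv; rewrite pmulr_rgt0// invr_gt0.
have [a0 b0] := sgn _ _ h1 (sqrtr_ge0 _).
have [c0 d0] := sgn _ _ h2 (sqrtr_ge0 _).
clearbody a b c d.
rewrite -lnV ?posrE ?divr_gt0 ?mulr_gt0// lnK ?posrE ?invr_gt0 ?divr_gt0 ?mulr_gt0//.
by field; rewrite !gt_eqF.
Qed.

(** Multiplicative form of: two inequalities whose sum is an equality are
    equalities. *)
Lemma eq_of_le_mul_eq (a b u v : R) : 0 < u -> 0 < v -> u <= a -> v <= b ->
  u * v = a * b -> a = u /\ b = v.
Proof.
move=> u0 v0 ua vb e.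
have vb' : v = b.
  apply/eqP; rewrite eq_le vb -(ler_pM2l u0) e ler_wpM2r//.
  exact: le_trans (ltW v0) vb.
by split=> //; apply: (@mulIf _ v); rewrite ?gt_eqF// e vb'.
Qed.

Lemma funk_ratio_geodesic x y z : D x -> D y -> D z ->
  hilbert_dist D x z = hilbert_dist D x y + hilbert_dist D y z ->
  fr x z = fr x y * fr y z /\ fr z x = fr z y * fr y x.
Proof.
move=> Dx Dy Dz h.
have /andP[p3 _] := funk_ratio_bounds Dx Dy.
have /andP[p4 _] := funk_ratio_bounds Dy Dz.
have /andP[p5 _] := funk_ratio_bounds Dz Dy.
have /andP[p6 _] := funk_ratio_bounds Dy Dx.
apply: eq_of_le_mul_eq; [exact: mulr_gt0|exact: mulr_gt0|..].
- exact: funk_ratio_triangle.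
- exact: funk_ratio_triangle.
- have := congr2 *%R (expR_hilbert_dist Dx Dy) (expR_hilbert_dist Dy Dz).
  rewrite -expRD -opprD -h (expR_hilbert_dist Dx Dz) => ->.
  by rewrite [RHS]mulrACA; congr (_ * _); exact: mulrC.
Qed.

(** Prolonging the segment from x to y beyond y by at most r stays in D, which
    bounds from below the weight of x in y, uniformly in x. *)
Lemma funk_ratio_near x y r d : D x -> ball y r `<=` D -> 0 < r ->
  `|y - x| < d -> r / (r + d) <= fr x y.
Proof.
move=> Dx yD r0 yxd.
have d0 : 0 < d := le_lt_trans (normr_ge0 _) yxd.
have rd : r + d != 0 by rewrite gt_eqF//; lra.
have Dy : D y by apply: yD; exact: ballxx.
apply: (@funk_ratio_max x y (y + (r / d) *: (y - x))) => //.
- apply/subset_closure/yD; rewrite -ball_normE /=.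
  have -> : y - (y + (r / d) *: (y - x)) = (- (r / d)) *: (y - x).
    by apply/rowP => i; rewrite !mxE; ring.
  rewrite normrZ normrN gtr0_norm ?divr_gt0// mulrAC ltr_pdivrMr//.
  by rewrite ltr_pM2l.
- by rewrite ler_pdivrMr; lra.
- apply/rowP => i; rewrite !mxE; field; by rewrite rd !gt_eqF.
Qed.

(** The Euclidean distance is controlled by a single Funk direction; this is why
    a ray of finite backward Funk length converges. *)
Lemma dist_funk_ratio x y M : D x -> D y ->
  (forall p, closure D p -> `|p| <= M) ->
  `|y - x| <= (1 - fr x y) * (2 * M).
Proof.
move=> Dx Dy hM; have [p cp yE] := funk_ratioP Dx Dy.
have /andP[_ r1] := funk_ratio_bounds Dx Dy.
have -> : y - x = (1 - fr x y) *: (p - x).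
  by rewrite {1}yE; apply/rowP => i; rewrite !mxE; ring.
rewrite normrZ ger0_norm ?subr_ge0// ler_wpM2l ?subr_ge0//.
apply: le_trans (ler_normB _ _) _; rewrite mulr2n mulrDl !mul1r.
by apply: lerD; apply: hM => //; exact: subset_closure.
Qed.

Lemma ball_funk_ratio x y r : ball x r `<=` D -> D x -> D y ->
  ball y (fr x y * r) `<=` D.
Proof.
move=> xD Dx Dy; case: (hD) => _ _ _ cD.
have [p cp yE] := funk_ratioP Dx Dy; have /andP[r0 r1] := funk_ratio_bounds Dx Dy.
by rewrite [X in ball X]yE; exact: ball_conv_closure.
Qed.

(** Let rho be the radius of the ball about o, and b the chord end beyond y.  The
    ball about y of [ball_funk_ratio] does not contain b, so
      r(o,y) rho <= |y b| = r(x,y) |x b| = r(x,o) r(o,y) |x b| <= r(o,y) |x b|.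
    The factor r(o,y), which may be arbitrarily small, cancels: |x b| >= rho, and
    |x y| = (1 - r(x,y)) |x b|. *)
Lemma funk_ratio_separation o x y r : ball o r `<=` D -> D o -> D x -> D y ->
  x != y -> fr x y = fr x o * fr o y -> 0 < r ->
  (1 - fr x y) * r <= `|y - x|.
Proof.
move=> oB Do Dx Dy xy xoy r0; case: (hD) => _ _ oD _.
have [b [bb yE l0 l1]] := funk_ratio_chord Dx Dy xy.
have [_ nb] := (boundary_openP _ oD).1 bb.
have /andP[u0 u1] := funk_ratio_bounds Dx Do.
have /andP[v0 v1] := funk_ratio_bounds Do Dy.
have yb : fr o y * r <= `|y - b|.
  rewrite leNgt; apply/negP => h; apply/nb/(ball_funk_ratio oB Do Dy).
  by rewrite -ball_normE.
have E1 : y - x = (1 - fr x y) *: (b - x).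
  by rewrite {1}yE; apply/rowP => i; rewrite !mxE; ring.
have E2 : y - b = (- fr x y) *: (b - x).
  by rewrite {1}yE; apply/rowP => i; rewrite !mxE; ring.
move: yb; rewrite E1 E2 !normrZ normrN (gtr0_norm l0) (@gtr0_norm _ (1 - _)); last first.
  by rewrite subr_gt0.
rewrite ler_pM2l ?subr_gt0// xoy => h.
have bx0 := normr_ge0 (b - x).
have : fr o y * r <= fr o y * `|b - x|.
  by apply: le_trans h _; rewrite [fr x o * _]mulrC -mulrA ler_pM2l// ler_piMl.
by rewrite ler_pM2l.
Qed.

End Funk.

(** * Geodesics *)

Section Geodesics.
Context {R : realType} {n : nat} {D : set 'rV[R]_n}.
Context (hD : bounded_convex_domain D).
Implicit Types (g : R -> 'rV[R]_n) (s t u : R) (I : set R).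
Local Notation fr := (funk_ratio D).

Definition geodesic_on I g : Prop :=
  (forall t, I t -> D (g t)) /\
  (forall s t, I s -> I t -> hilbert_dist D (g s) (g t) = `|s - t|).

Lemma geodesic_funk_ratio I g s t u : geodesic_on I g -> I s -> I t -> I u ->
  s <= t -> t <= u ->
  fr (g s) (g u) = fr (g s) (g t) * fr (g t) (g u) /\
  fr (g u) (g s) = fr (g u) (g t) * fr (g t) (g s).
Proof.
move=> [gD gh] Is It Iu st tu.
have h : hilbert_dist D (g s) (g u) =
         hilbert_dist D (g s) (g t) + hilbert_dist D (g t) (g u).
  rewrite (gh _ _ Is Iu) (gh _ _ Is It) (gh _ _ It Iu).
  by rewrite !ler0_norm; lra.
exact: (funk_ratio_geodesic hD (gD _ Is) (gD _ It) (gD _ Iu) h).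
Qed.

Lemma geodesic_expR I g s t : geodesic_on I g -> I s -> I t ->
  expR (- `|s - t|) = fr (g s) (g t) * fr (g t) (g s).
Proof.
move=> [gD gh] Is It; rewrite -(gh _ _ Is It).
exact: (expR_hilbert_dist hD (gD _ Is) (gD _ It)).
Qed.

Lemma geodesic_neq I g s t : geodesic_on I g -> I s -> I t -> s != t -> g s != g t.
Proof.
move=> [_ gh] Is It; apply: contra => /eqP e.
by rewrite -subr_eq0 -normr_eq0 -(gh _ _ Is It) e /hilbert_dist eqxx.
Qed.

(** The displacement of g between two times is at most a constant times the
    decrease of a t = r(g t, g 0), a monotone function bounded below. *)
Lemma ray_cvg g : geodesic_ray D g -> cvg (g t @[t --> +oo]).
Proof.
move=> ray; case: (hD) => _ bD oD _; have [gD _] := ray.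
have rayI : geodesic_on [set t | 0 <= t] g := ray.
have D0 : D (g 0) by exact: gD.
have [M M0 hM] := bounded_norm bD.
have [r r0 rD] := open_ball oD D0.
(* 2 M + 1 strictly exceeds all distances in D. *)
pose a t := fr (g t) (g 0); pose c := r / (r + (2 * M + 1)).
have c0 : 0 < c by rewrite divr_gt0//; lra.
have ca t : 0 <= t -> c <= a t.
  move=> t0; apply: (funk_ratio_near hD (gD _ t0) rD r0).
  apply: le_lt_trans (ler_normB _ _) _.
  have h1 := hM _ (subset_closure D0); have h2 := hM _ (subset_closure (gD _ t0)).
  lra.
have step s t : 0 <= s -> s <= t -> `|g s - g t| <= 2 * M / c * (a s - a t).
  move=> s0 st; have t0 := le_trans s0 st.
  have [_ h] := geodesic_funk_ratio rayI (lexx 0 : [set t | 0 <= t] 0) s0 t0 s0 st.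
  apply: le_trans (dist_funk_ratio hD (gD _ t0) (gD _ s0) hM) _.
  have /andP[_ f1] := funk_ratio_bounds hD (gD _ t0) (gD _ s0).
  rewrite /a h; move: (ca s s0) f1; rewrite /a.
  move: (fr (g t) (g s)) (fr (g s) (g 0)) => f b cb f1.
  have -> : 2 * M / c * (b - f * b) = ((1 - f) * (2 * M)) * (b / c).
    by field; rewrite gt_eqF.
  rewrite ler_peMr//; first by rewrite mulr_ge0//; lra.
  by rewrite ler_pdivlMr// mul1r.
apply/cauchy_cvgP/cauchy_exP => e e0.
pose S := [set a t | t in [set t | 0 <= t]].
have iS : has_inf S.
  split; first by exists (a 0), 0 => //=.
  by exists c => _ [t t0 <-]; exact: ca.
pose K := 2 * M / c.
have K0 : 0 < K by rewrite divr_gt0// mulr_gt0.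
have [|_ [T /= T0 <-] aT] := inf_adherent (_ : 0 < e / K) iS; first exact: divr_gt0.
exists (g T); near=> t; rewrite -ball_normE /=.
have Tt : T <= t by near: t; apply: nbhs_pinfty_ge; exact: num_real.
apply: le_lt_trans (step _ _ T0 Tt) _; rewrite -/K mulrC -ltr_pdivlMr//.
have : inf S <= a t.
  by apply: ge_inf; [exact: iS.2 | exists t => //=; exact: le_trans Tt].
lra.
Unshelve. all: by end_near. Qed.

(** If the limit were in D, both Funk ratios between g 0 and g t would be
    bounded below for large t, although their product is exp (- t). *)
Lemma ray_limit_boundary g xi : geodesic_ray D g -> g t @[t --> +oo] --> xi ->
  boundary D xi.
Proof.
move=> ray gxi; case: (hD) => _ bD oD _; have [gD _] := ray.
have rayI : geodesic_on [set t | 0 <= t] g := ray.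
have D0 : D (g 0) by exact: gD.
have [M M0 hM] := bounded_norm bD.
apply/boundary_openP => //; split.
  apply/closureP => e e0; near +oo_R => t; exists (g t).
    by apply: gD; near: t; apply: nbhs_pinfty_ge; exact: num_real.
  by near: t; exact: (cvgrPdist_lt _ _).1 gxi _ e0.
move=> Dxi.
have [r r0 rD] := open_ball oD Dxi; have [r' r'0 r'D] := open_ball oD D0.
have r20 : 0 < r / 2 by rewrite divr_gt0.
pose c := (r / 2) / (r / 2 + (2 * M + 1)); pose c' := r' / (r' + (2 * M + 1)).
have c0 : 0 < c by rewrite divr_gt0//; lra.
have c'0 : 0 < c' by rewrite divr_gt0//; lra.
have far x y : D x -> D y -> `|x - y| < 2 * M + 1.
  move=> Dx Dy; apply: le_lt_trans (ler_normB _ _) _.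
  have h1 := hM _ (subset_closure Dx); have h2 := hM _ (subset_closure Dy).
  lra.
have near_xi := (cvgrPdist_lt _ _).1 gxi _ r20.
suff [t [t0 tL tr]] : exists t, [/\ 0 <= t, - ln (c * c') < t & `|xi - g t| < r / 2].
  have Bt : ball (g t) (r / 2) `<=` D.
    move=> z; rewrite -ball_normE /= => gz; apply: rD; rewrite -ball_normE /=.
    rewrite -(subrK (g t) xi) -addrA; apply: le_lt_trans (ler_normD _ _) _.
    lra.
  have h1 := funk_ratio_near hD D0 Bt r20 (far _ _ (gD _ t0) D0).
  have h2 := funk_ratio_near hD (gD _ t0) r'D r'0 (far _ _ D0 (gD _ t0)).
  have := geodesic_expR rayI (lexx 0 : [set t | 0 <= t] 0) t0.
  rewrite sub0r normrN ger0_norm// => e.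
  have : c * c' <= expR (- t) by rewrite e ler_pM// ltW.
  have -> : c * c' = expR (ln (c * c')) by rewrite lnK// posrE mulr_gt0.
  by rewrite ler_expR; lra.
near +oo_R => t; exists t; split; near: t; last exact: near_xi.
- by apply: nbhs_pinfty_ge; exact: num_real.
- by apply: nbhs_pinfty_gt; exact: num_real.
Unshelve. all: by end_near. Qed.

Section Complete.
Context (G : R -> 'rV[R]_n) (hG : complete_geodesic D G).

Let GI : geodesic_on setT G.
Proof. by case: hG => h1 h2; split=> *; auto. Qed.

Let GD t : D (G t). Proof. by case: hG. Qed.

Lemma complete_ray : geodesic_ray D G.
Proof. by case: hG => h1 h2; split=> *; auto. Qed.

Lemma complete_reverse_ray : geodesic_ray D (fun t => G (- t)).
Proof.
case: hG => h1 h2; split=> [t _|s t _ _]; first exact: h1.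
by rewrite h2 -normrN; congr `|_|; ring.
Qed.

(** [funk_ratio_separation] at o = G 0 applies with one constant for all t >= 1,
    because r(G (- t), G t) is at most r(G (- 1), G 1) < 1. *)
Lemma complete_separated : exists2 d, 0 < d &
  forall t, 1 <= t -> d <= `|G t - G (- t)|.
Proof.
case: (hD) => _ _ oD _.
have [r r0 rD] := open_ball oD (GD 0).
have N : G (-1) != G 1 by apply: (geodesic_neq GI) => //; rewrite lt_eqF//; lra.
have [_ [_ _ _ k1]] := funk_ratio_chord hD (GD (-1)) (GD 1) N.
exists ((1 - fr (G (-1)) (G 1)) * r); first by rewrite mulr_gt0// subr_gt0.
move=> t t1.
have N' : G (- t) != G t by apply: (geodesic_neq GI) => //; rewrite lt_eqF//; lra.
have mul s v u : s <= v -> v <= u ->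
    fr (G s) (G u) = fr (G s) (G v) * fr (G v) (G u).
  by move=> sv vu; case: (@geodesic_funk_ratio setT G s v u GI _ _ _ sv vu).
have E0 : fr (G (- t)) (G t) = fr (G (- t)) (G 0) * fr (G 0) (G t).
  by apply: mul; lra.
apply: le_trans (funk_ratio_separation hD rD (GD 0) (GD (- t)) (GD t) N' E0 r0).
rewrite ler_pM2r// lerD2l lerN2.
have E1 : fr (G (- t)) (G t) = fr (G (- t)) (G (- 1)) * fr (G (- 1)) (G t).
  by apply: mul; lra.
have E2 : fr (G (- 1)) (G t) = fr (G (- 1)) (G 1) * fr (G 1) (G t).
  by apply: mul; lra.
have /andP[x0 x1] := funk_ratio_bounds hD (GD (- t)) (GD (- 1)).
have /andP[y0 y1] := funk_ratio_bounds hD (GD 1) (GD t).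
have /andP[z0 _] := funk_ratio_bounds hD (GD (- 1)) (GD 1).
rewrite E1 E2; move: x0 x1 y0 y1 z0.
move: (fr (G (- t)) (G (- 1))) (fr (G 1) (G t)) (fr (G (- 1)) (G 1)).
move=> x y z x0 x1 y0 y1 z0.
apply: le_trans (_ : z * y <= z); first by rewrite ler_piMl// mulr_ge0// ltW.
by rewrite ler_piMr// ltW.
Qed.

(** If a ball of radius r about G 0 lies in D, then so does the ball of radius
    exp (- T) r about G s whenever |s| <= T; no boundary point is in it. *)
Lemma accumulation_unbounded xi (t : nat -> R) T : boundary D xi ->
  G (t k) @[k --> \oo] --> xi -> \forall k \near \oo, T < `|t k|.
Proof.
move=> bxi; case: (hD) => _ _ oD _; have [_ nxi] := (boundary_openP xi oD).1 bxi.
have [r r0 rD] := open_ball oD (GD 0).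
have e0 : 0 < expR (- T) * r by rewrite mulr_gt0// expR_gt0.
move=> /cvgrPdist_lt /(_ _ e0); apply: filterS => k xik.
rewrite ltNge; apply/negP => kT; apply: nxi.
apply: (ball_funk_ratio hD rD (GD 0) (GD (t k))).
rewrite -ball_normE /= distrC; apply: lt_le_trans xik _.
rewrite ler_pM2r//; apply: (@le_trans _ _ (expR (- `|0 - t k|))).
  by rewrite ler_expR lerN2 sub0r normrN.
rewrite (@geodesic_expR setT G 0 (t k) GI)//.
have /andP[_ x1] := funk_ratio_bounds hD (GD (t k)) (GD 0).
have /andP[x0 _] := funk_ratio_bounds hD (GD 0) (GD (t k)).
by rewrite ler_piMr// ltW.
Qed.

(** A sequence G (t k) with |t k| tending to infinity may alternate between the
    two ends; but then each of its terms is eventually close to one of the two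
    limits, so a limit of the sequence is one of them. *)
Lemma accumulation_complete xi1 xi2 :
  G t @[t --> +oo] --> xi1 -> G (- t) @[t --> +oo] --> xi2 ->
  boundary_accumulation D G = [set xi1; xi2].
Proof.
move=> G1 G2; apply/seteqP; split=> [xi [bxi [t txi]]|xi].
  apply: contrapT => /not_orP[/eqP n1 /eqP n2].
  have m1 : 0 < `|xi - xi1| by rewrite normr_gt0 subr_eq0.
  have m2 : 0 < `|xi - xi2| by rewrite normr_gt0 subr_eq0.
  pose e := Num.min `|xi - xi1| `|xi - xi2| / 2.
  have e1 : e <= `|xi - xi1| / 2 by rewrite ler_pM2r// ge_min lexx.
  have e2 : e <= `|xi - xi2| / 2 by rewrite ler_pM2r// ge_min lexx orbT.
  have e0 : 0 < e by rewrite divr_gt0// lt_min m1 m2.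
  have [T1 [_ hT1]] := (cvgrPdist_lt _ _).1 G1 _ e0.
  have [T2 [_ hT2]] := (cvgrPdist_lt _ _).1 G2 _ e0.
  near \oo => k.
  have k0 : `|xi - G (t k)| < e by near: k; exact: (cvgrPdist_lt _ _).1 txi _ e0.
  have kT : Num.max T1 T2 < `|t k|.
    by near: k; apply: accumulation_unbounded txi.
  move: kT; rewrite gt_max => /andP[k1 k2].
  have tri z : `|xi - z| <= `|xi - G (t k)| + `|z - G (t k)|.
    by rewrite [`|z - _|]distrC; exact: ler_distD.
  have [tk|tk] := leP 0 (t k).
    rewrite ger0_norm// in k1; have := hT1 _ k1; have := tri xi1 => /= u v; lra.
  rewrite ltr0_norm// in k2; have := hT2 _ k2; rewrite /= opprK.
  by have := tri xi2 => /= u v; lra.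
case=> ->.
  split; first exact: ray_limit_boundary complete_ray G1.
  exists (fun k => k%:R); exact: (cvg_comp _ _ cvgr_idn G1).
split; first exact: ray_limit_boundary complete_reverse_ray G2.
exists (fun k => - k%:R); exact: (cvg_comp _ _ cvgr_idn G2).
Unshelve. all: by end_near. Qed.

End Complete.
End Geodesics.

Theorem theorem3 (R : realType) (n : nat) (hn : (1 <= n)%N)
    (D : set 'rV[R]_n) (hD : bounded_convex_domain D) :
  (forall g : R -> 'rV[R]_n, geodesic_ray D g ->
     exists2 xi : 'rV[R]_n, boundary D xi & g t @[t --> +oo] --> xi) /\
  (forall G : R -> 'rV[R]_n, complete_geodesic D G ->
     (boundary_accumulation D G #= `I_2)%card).
Proof.
split=> [g ray|G hG].
  have /cvg_ex[xi gxi] := ray_cvg hD ray.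
  by exists xi => //; exact: ray_limit_boundary ray gxi.
have /cvg_ex[xi1 G1] := ray_cvg hD (complete_ray hG).
have /cvg_ex[xi2 G2] := ray_cvg hD (complete_reverse_ray hG).
rewrite (accumulation_complete hD hG G1 G2).
have n12 : xi1 <> xi2.
  move=> e; have [d d0 sep] := complete_separated hD hG.
  have d20 : 0 < d / 2 by rewrite divr_gt0.
  near +oo_R => t.
  have t1 : 1 <= t by near: t; apply: nbhs_pinfty_ge; exact: num_real.
  have h1 : `|xi1 - G t| < d / 2 by near: t; exact: (cvgrPdist_lt _ _).1 G1 _ d20.
  have h2 : `|xi2 - G (- t)| < d / 2 by near: t; exact: (cvgrPdist_lt _ _).1 G2 _ d20.
  have := sep t t1; have := ler_distD xi1 (G t) (G (- t)).
  rewrite [`|G t - xi1|]distrC {2}e; lra.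
apply/eq_cardSP; exists xi1; first by left.
have -> : [set xi1; xi2] `\ xi1 = [set xi2].
  apply/seteqP; split=> [x [[->|->]]|x ->] //=.
  by split; [right|move=> h; apply: n12].
exact: card_set1.
Unshelve. all: by end_near. Qed.
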